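(* Let $(\cdot,\cdot)^h_q$ be the discrete horizontal lift of a discrete connection on $\pi:Q\to S$. Then the discrete connection $1$-form $\mathcal{A}_d:Q\times Q\to G$ is uniquely defined by the identity $$i_{q_0}(\mathcal{A}_d(q_0,q_1))\cdot(\pi q_0,\pi q_1)^h_{q_0}=(q_0,q_1)\qquad\text{for all }(q_0,q_1)\in Q\times Q;$$ that is, for every $(q_0,q_1)$ there is exactly one element of $G$ satisfying this identity in place of $\mathcal{A}_d(q_0,q_1)$, and the resulting map is the discrete connection $1$-form.
   Context: $Q$ is a smooth manifold with a free smooth left action $(g,q)\mapsto gq$ of a Lie group $G$ such that the projection $\pi:Q\to S=Q/G$ is a submersion. $G$ acts on $Q\times Q$ diagonally. The discrete generator is $i_q(g)=(q,gq)$, and the discrete vertical space at $q$ is $\operatorname{Ver}_q=\{i_q(g)\mid g\in G\}$. The composition of a vertical element with an arbitrary element is $i_{q_0}(g)\cdot(q_0,q_1)=(q_0,gq_1)$. A discrete connection is a $G$-invariant subset $\operatorname{Hor}\subset Q\times Q$ ($\operatorname{Hor}_q$ denotes its elements with first component $q$) complementary to the vertical space: $\operatorname{Hor}_q\cap\operatorname{Ver}_q=\{(q,q)\}$ for every $q$, and every $(q_0,q_1)\in Q\times Q$ can be written uniquely as $(q_0,q_1)=\operatorname{ver}(q_0,q_1)\cdot\operatorname{hor}(q_0,q_1)$ with $\operatorname{ver}(q_0,q_1)\in\operatorname{Ver}_{q_0}$ and $\operatorname{hor}(q_0,q_1)\in\operatorname{Hor}_{q_0}$. Its discrete connection $1$-form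 assigns to $(q_0,q_1)$ the unique $g\in G$ with $i_{q_0}(g)=\operatorname{ver}(q_0,q_1)$. Its discrete horizontal lift assigns to $(x_0,x_1)\in S\times S$ and $q\in\pi^{-1}(x_0)$ the unique element $(x_0,x_1)^h_q=(q,q')$ of $\operatorname{Hor}_q$ with $\pi(q')=x_1$. *)

(* Defs.v *)
From HB Require Import structures.
From mathcomp Require Import all_boot all_order all_algebra.
From mathcomp Require Import all_classical all_reals all_analysis.

Set Implicit Arguments.
Unset Strict Implicit.
Unset Printing Implicit Defensive.

Import Order.TTheory GRing.Theory Num.Theory.
Import numFieldNormedType.Exports.

Local Open Scope classical_set_scope.
Local Open Scope ring_scope.
Local Open Scope quotient_scope.

(* C^oo on an open set U: all iterated partial derivatives exist and are
   continuous at the points of U. Functions are total, but only their germs at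
   the points of U matter. *)
Definition partials (R : realType) (m n : nat) (s : seq 'I_m)
    (f : 'rV[R]_m -> 'rV[R]_n) : 'rV[R]_m -> 'rV[R]_n :=
  foldr (fun i h x => 'D_(delta_mx 0 i) h x) f s.

Definition smooth_on (R : realType) (m n : nat) (U : set 'rV[R]_m)
    (f : 'rV[R]_m -> 'rV[R]_n) : Prop :=
  forall (s : seq 'I_m) (x : 'rV[R]_m), U x ->
    {for x, continuous (partials s f)} /\
    forall i : 'I_m, derivable (partials s f) x (delta_mx 0 i).

(* [coord] is meant on [dom] and [param], its inverse, on [coord @` dom];
   their values elsewhere are irrelevant. *)
Record chart (R : realType) (n : nat) (M : Type) := Chart {
  dom : set M;
  coord : M -> 'rV[R]_n;
  param : 'rV[R]_n -> M
}.

Definition is_chart (R : realType) (n : nat) (M : topologicalType)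
    (c : chart R n M) : Prop :=
  [/\ open (dom c), open (coord c @` dom c),
      (forall x, dom c x -> param c (coord c x) = x),
      {within dom c, continuous (coord c)} &
      {within coord c @` dom c, continuous (param c)}].

Definition smoothly_compatible (R : realType) (n : nat) (M : Type)
    (c d : chart R n M) : Prop :=
  smooth_on (coord c @` (dom c `&` dom d)) (coord d \o param c).

Definition smooth_manifold (R : realType) (n : nat) (M : topologicalType)
    (A : set (chart R n M)) : Prop :=
  [/\ hausdorff_space M, @second_countable M,
      (forall c, A c -> is_chart c),
      (forall x, exists2 c, A c & dom c x) &
      (forall c d, A c -> A d -> smoothly_compatible c d)].

Definition smooth_map (R : realType) (m n : nat) (M N : topologicalType)
    (A : set (chart R m M)) (B : set (chart R n N)) (f : M -> N) : Prop :=
  continuous f /\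
  forall c d, A c -> B d ->
    smooth_on (coord c @` (dom c `&` f @^-1` dom d)) (coord d \o f \o param c).

(* Surjectivity of the tangent map, read in charts. *)
Definition submersion (R : realType) (m n : nat) (M N : topologicalType)
    (A : set (chart R m M)) (B : set (chart R n N)) (f : M -> N) : Prop :=
  smooth_map A B f /\
  forall c d x, A c -> B d -> dom c x -> dom d (f x) ->
    range ('d (coord d \o f \o param c) (coord c x)) = [set: 'rV[R]_n].

Definition prod_chart (R : realType) (m n : nat) (M N : Type)
    (c : chart R m M) (d : chart R n N) : chart R (m + n) (M * N) :=
  Chart (dom c `*` dom d)
        (fun p => row_mx (coord c p.1) (coord d p.2))
        (fun v => (param c (lsubmx v), param d (rsubmx v))).

Definition prod_atlas (R : realType) (m n : nat) (M N : Type)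
    (A : set (chart R m M)) (B : set (chart R n N)) :
    set (chart R (m + n) (M * N)) :=
  [set e | exists c d, [/\ A c, B d & e = prod_chart c d]].

(* A group and a topology on the same carrier, with no compatibility between
   them: the latter is part of [lie_group]. *)
#[short(type="groupTopologicalType")]
HB.structure Definition GroupTopological := {G of Topological G & Group G}.

Definition lie_group (R : realType) (k : nat) (G : groupTopologicalType)
    (A : set (chart R k G)) : Prop :=
  [/\ smooth_manifold A,
      smooth_map (prod_atlas A A) A (fun p : G * G => (p.1 * p.2)%g) &
      smooth_map A A (fun g : G => g^-1%g)].

Record left_action (G : groupType) (Q : Type) := LeftAction {
  act :> G -> Q -> Q;
  act1 : forall q, act 1%g q = q;
  actM : forall g h q, act (g * h)%g q = act g (act h q)
}.

Definition free_action (G : groupType) (Q : Type) (a : left_action G Q) : Prop :=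
  forall g q, a g q = q -> g = 1%g.

Definition smooth_action (R : realType) (k n : nat)
    (G : groupTopologicalType) (Q : topologicalType)
    (AG : set (chart R k G)) (AQ : set (chart R n Q))
    (a : left_action G Q) : Prop :=
  smooth_map (prod_atlas AG AQ) AQ (fun p : G * Q => a p.1 p.2).

Section OrbitSpace.
Context (G : groupType) (Q : topologicalType) (a : left_action G Q).

Definition orbit_rel (q q' : Q) : bool := `[< exists g, q' = a g q >].

Lemma orbit_rel_refl : reflexive orbit_rel.
Proof. by move=> q; apply/asboolP; exists 1%g; rewrite act1. Qed.

Lemma orbit_rel_sym : symmetric orbit_rel.
Proof.
suff H q q' : orbit_rel q q' -> orbit_rel q' q.
  by move=> q q'; apply/idP/idP; exact: H.
move=> /asboolP[g ->]; apply/asboolP; exists (g^-1)%g.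
by rewrite -actM mulVg act1.
Qed.

Lemma orbit_rel_trans : transitive orbit_rel.
Proof.
move=> q' q q'' /asboolP[g ->] /asboolP[h ->]; apply/asboolP.
by exists (h * g)%g; rewrite actM.
Qed.

Canonical orbit_equiv :=
  EquivRel orbit_rel orbit_rel_refl orbit_rel_sym orbit_rel_trans.

Definition orbit_space : Type := quotient_topology {eq_quot orbit_equiv}.
HB.instance Definition _ := Topological.copy orbit_space
  (quotient_topology {eq_quot orbit_equiv}).

Definition orbit_proj (q : Q) : orbit_space := \pi_{eq_quot orbit_equiv} q.

Lemma orbit_projP q q' : orbit_proj q = orbit_proj q' <-> exists g, q' = a g q.
Proof. by split=> [/eqmodP/asboolP|?]; last by apply/eqmodP/asboolP. Qed.

Lemma orbit_proj_surj (x : orbit_space) : exists q, orbit_proj q = x.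
Proof. by exists (repr (x : {eq_quot orbit_equiv})); exact: reprK. Qed.

End OrbitSpace.

Section DiscreteConnection.
Context (G : groupType) (Q : topologicalType) (a : left_action G Q).

Definition diag_act (g : G) (p : Q * Q) : Q * Q := (a g p.1, a g p.2).

Definition dgen (q : Q) (g : G) : Q * Q := (q, a g q).

Definition Ver (q : Q) : set (Q * Q) := range (dgen q).

Definition fiber1 (H : set (Q * Q)) (q : Q) : set (Q * Q) :=
  [set p | H p /\ p.1 = q].

(* The composition v . p of a vertical v with an element p having the same
   first component; for a free action [v] determines the group element used,
   see [vcompE]. *)
Definition vcomp (v p : Q * Q) : Q * Q :=
  (v.1, a (xget 1%g [set g | dgen v.1 g = v]) p.2).

Record discrete_connection := DiscreteConnection {
  Hor :> set (Q * Q);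
  Hor_inv : forall g p, Hor p -> Hor (diag_act g p);
  Hor_Ver : forall q, fiber1 Hor q `&` Ver q = [set (q, q)];
  Hor_decomp : forall q0 q1, exists! vh : (Q * Q) * (Q * Q),
    [/\ Ver q0 vh.1, fiber1 Hor q0 vh.2 & (q0, q1) = vcomp vh.1 vh.2]
}.

(* In the next definitions, [xget] picks the unique element of the set; its
   first argument is a default value that is never used (for [hlift], as long
   as q lies over x0): see [ver_horP], [connection_formP] and [hliftP]. *)
Definition ver_hor (H : discrete_connection) (p : Q * Q) :
    (Q * Q) * (Q * Q) :=
  xget (p, p) [set vh | [/\ Ver p.1 vh.1, fiber1 H p.1 vh.2 &
                            p = vcomp vh.1 vh.2]].

Definition ver (H : discrete_connection) (p : Q * Q) : Q * Q :=
  (ver_hor H p).1.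

Definition hor (H : discrete_connection) (p : Q * Q) : Q * Q :=
  (ver_hor H p).2.

Definition connection_form (H : discrete_connection) (p : Q * Q) : G :=
  xget 1%g [set g | dgen p.1 g = ver H p].

Definition hlift (H : discrete_connection) (x0 x1 : orbit_space a) (q : Q) :
    Q * Q :=
  xget (q, q) [set p | [/\ orbit_proj a q = x0, fiber1 H q p &
                           orbit_proj a p.2 = x1]].

Hypothesis a_free : free_action a.

Lemma dgen_inj q : injective (dgen q).
Proof.
move=> g h [] /(congr1 (a h^-1%g)); rewrite -!actM mulVg act1 => /a_free e.
by rewrite -[g](mulVKg h) e mulg1.
Qed.

Lemma vcompE q0 g q1 : vcomp (dgen q0 g) (q0, q1) = (q0, a g q1).
Proof.
by rewrite /vcomp (@xget_unique _ _ _ g) //= => h /(@dgen_inj q0).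
Qed.

Lemma ver_horP (H : discrete_connection) p :
  [/\ Ver p.1 (ver H p), fiber1 H p.1 (hor H p) &
      p = vcomp (ver H p) (hor H p)].
Proof.
case: p => q0 q1; have [vh [vhP _]] := Hor_decomp H q0 q1.
exact: (xgetI (_ : (Q * Q) * (Q * Q))
  (P := [set vh | [/\ Ver q0 vh.1, fiber1 H q0 vh.2 &
                     (q0, q1) = vcomp vh.1 vh.2]]) vhP).
Qed.

Lemma connection_formP (H : discrete_connection) p g :
  dgen p.1 g = ver H p <-> g = connection_form H p.
Proof.
have [[h _ hP] _ _] := ver_horP H p.
have cP : dgen p.1 (connection_form H p) = ver H p.
  exact: (xgetI _ (P := [set g | dgen p.1 g = ver H p]) hP).
by split=> [|->//]; rewrite -cP; exact: dgen_inj.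
Qed.

Lemma hliftP (H : discrete_connection) q x1 p :
  (fiber1 H q p /\ orbit_proj a p.2 = x1) <->
  p = hlift H (orbit_proj a q) x1 q.
Proof.
have [q1 q1E] := orbit_proj_surj x1.
have [[g _ gP] [h1 h2] h3] := ver_horP H (q, q1).
have ex : exists p', [/\ orbit_proj a q = orbit_proj a q, fiber1 H q p' &
                          orbit_proj a p'.2 = x1].
  exists (hor H (q, q1)); split=> //; rewrite -q1E; apply/orbit_projP; exists g.
  move: h2 h3; rewrite -gP /=; case: (hor _ _) => /= u v ->.
  by rewrite vcompE => -[].
have := @xgetPex _ (q, q) [set p' | [/\ orbit_proj a q = orbit_proj a q,
  fiber1 H q p' & orbit_proj a p'.2 = x1]] ex.
rewrite -/(hlift H _ x1 q); move: (hlift _ _ _ _) => l [_ lH lx].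
split=> [[pH px]|->//].
have /orbit_projP[h hE] : orbit_proj a l.2 = orbit_proj a p.2 by rewrite lx px.
have [vh [_ U]] := Hor_decomp H q p.2.
have e1 : vh = (dgen q 1%g, p).
  apply: U; split=> //=; first by exists 1%g.
  by case: p pH {px hE} => u v [_ /= ->]; rewrite vcompE act1.
have e2 : vh = (dgen q h, l).
  apply: U; split=> //=; first by exists h.
  by rewrite hE; case: l lH {lx hE} => u v [_ /= ->]; rewrite vcompE.
by move: e2; rewrite e1 => -[].
Qed.

End DiscreteConnection.

(* Main.v *)
Require Import Defs.
From mathcomp Require Import all_boot all_order all_algebra.
From mathcomp Require Import all_classical all_reals all_analysis.

(** The splitting [(q0, q1) = ver . hor] already is the required identity: [ver] is generated by the
    connection form, and [hor] is the horizontal lift ([hor_hlift]), which gives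
    [vcomp_connection_form]. Uniqueness is cancellation in a free action ([vcomp_dgen_inj]). *)

(* The horizontal part of (q0, q1) lies over (pi q0, pi q1), because the group
   element of the vertical part carries its second component to q1; it is
   therefore the horizontal lift. *)
Lemma hor_hlift {G : groupType} {Q : topologicalType} {a : left_action G Q}
    (a_free : free_action a) (H : discrete_connection a) (q0 q1 : Q) :
  hor H (q0, q1) = hlift H (orbit_proj a q0) (orbit_proj a q1) q0.
Proof.
have [[g _ gver] Hhor E] := ver_horP H (q0, q1).
rewrite -gver in E; apply/(hliftP a_free); split=> //.
apply/orbit_projP; exists g.
(* [vcomp] reads only the second component of its last argument, so [vcompE] applies up to
   conversion. *)
exact: (congr1 snd (etrans E (vcompE a_free q0 g (hor H (q0, q1)).2))).
Qed.

Lemma vcomp_connection_form {G : groupType} {Q : topologicalType}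
    {a : left_action G Q} (a_free : free_action a) (H : discrete_connection a)
    (q0 q1 : Q) :
  vcomp a (dgen a q0 (connection_form H (q0, q1)))
    (hlift H (orbit_proj a q0) (orbit_proj a q1) q0) = (q0, q1).
Proof.
have [_ _ E] := ver_horP H (q0, q1).
by rewrite -(hor_hlift a_free) (connection_formP a_free H (q0, q1) _).2 // -E.
Qed.

(** Freeness enters twice: at [q], so that the vertical element determines [g], and at [p.2], to
    cancel the action. *)
Lemma vcomp_dgen_inj {G : groupType} {Q : topologicalType}
    {a : left_action G Q} (a_free : free_action a) (q : Q) (p : Q * Q) :
  injective (fun g => vcomp a (dgen a q g) p).
Proof.
have vE g : vcomp a (dgen a q g) p = (q, a g p.2) := vcompE a_free q g p.2.
move=> g h; rewrite /= !vE => -[e].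
by apply: (dgen_inj a_free (q := p.2)); rewrite /dgen e.
Qed.

Theorem lemma4p8 (R : realType) (k n m : nat)
    (G : groupTopologicalType) (AG : set (chart R k G))
    (Q : topologicalType) (AQ : set (chart R n Q))
    (a : left_action G Q) (AS : set (chart R m (orbit_space a)))
    (hG : lie_group AG)
    (hQ : smooth_manifold AQ)
    (a_smooth : smooth_action AG AQ a)
    (a_free : free_action a)
    (hS : smooth_manifold AS)
    (hpi : submersion AQ AS (orbit_proj a))
    (H : discrete_connection a) :
  (forall q0 q1 : Q, exists! g : G,
     vcomp a (dgen a q0 g) (hlift H (orbit_proj a q0) (orbit_proj a q1) q0)
       = (q0, q1)) /\
  (forall A : Q * Q -> G,
     (forall q0 q1 : Q,
        vcomp a (dgen a q0 (A (q0, q1)))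
          (hlift H (orbit_proj a q0) (orbit_proj a q1) q0) = (q0, q1))
     <-> A = connection_form H).
Proof.
(* Uniqueness of the group element and of the whole map both reduce to this cancellation. *)
have inj q0 q1 := vcomp_dgen_inj a_free q0
  (hlift H (orbit_proj a q0) (orbit_proj a q1) q0).
split=> [q0 q1|A].
  exists (connection_form H (q0, q1)).
  split=> [|g gE]; first exact: vcomp_connection_form.
  by apply: (inj q0 q1); rewrite /= gE; apply: vcomp_connection_form.
split=> [AE|-> q0 q1]; last exact: vcomp_connection_form.
apply/funext => -[q0 q1]; apply: (inj q0 q1).
by rewrite /= AE; apply/esym/vcomp_connection_form.
Qed.
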